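(* Let $k\geq 2$ be an integer, let $n$ be sufficiently large, and let $G$ be a connected graph of order $n$. If $e(G)\geq e(S_{n,k}^{+})=kn-\frac{k(k+1)}{2}+1$, then $G$ contains $B_{2,2k+1}$ as a subgraph.
   Context: All graphs are finite, simple and undirected. The order of a graph is its number of vertices, and $e(G)$ is the number of edges of $G$. ''Contains as a subgraph'' means a not necessarily induced subgraph (up to isomorphism). $S_{n,k}=K_k\vee\overline{K_{n-k}}$ is the graph of order $n$ obtained by joining every vertex of a complete graph $K_k$ to every vertex of an independent set of order $n-k$; $S_{n,k}^{+}$ is obtained from $S_{n,k}$ by adding a single edge joining two vertices of the independent set. For integers $s,t\geq 1$, the broom $B_{s,t}$ is the tree on $s+t$ vertices obtained by identifying the center of a star $K_{1,s}$ with an end-vertex of a path $P_t$ on $t$ vertices. ''Sufficiently large $n$'' means $n\ge n_0$ for some threshold $n_0$ depending only on $k$. *)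

(* Defs.v *)
From mathcomp Require Import all_boot.

Set Implicit Arguments.
Unset Strict Implicit.
Unset Printing Implicit Defensive.

Record sgraph := SGraph {
  vertex :> finType;
  adj : rel vertex;
  adj_sym : symmetric adj;
  adj_irr : irreflexive adj }.

Definition gorder (G : sgraph) : nat := #|vertex G|.

Definition edges (G : sgraph) : {set {set G}} :=
  [set A | [exists x : G, exists y : G, adj x y && (A == [set x; y])]].

Definition num_edges (G : sgraph) : nat := #|edges G|.

Definition connected (G : sgraph) : Prop := forall x y : G, connect (@adj G) x y.

Definition contains (G H : sgraph) : Prop :=
  exists2 f : H -> G, injective f & forall x y : H, adj x y -> adj (f x) (f y).

Section Complete.
Variable n : nat.
Definition complete_adj : rel 'I_n := fun x y => x != y.
Lemma complete_sym : symmetric complete_adj.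
Proof. by move=> x y; rewrite /complete_adj eq_sym. Qed.
Lemma complete_irr : irreflexive complete_adj.
Proof. by move=> x; rewrite /complete_adj eqxx. Qed.
Definition complete := SGraph complete_sym complete_irr.
End Complete.

Section Complement.
Variable G : sgraph.
Definition compl_adj : rel G := fun x y => (x != y) && ~~ adj x y.
Lemma compl_sym : symmetric compl_adj.
Proof. by move=> x y; rewrite /compl_adj eq_sym adj_sym. Qed.
Lemma compl_irr : irreflexive compl_adj.
Proof. by move=> x; rewrite /compl_adj eqxx. Qed.
Definition compl := SGraph compl_sym compl_irr.
End Complement.

Section Join.
Variables G H : sgraph.
Definition gjoin_adj : rel (G + H)%type := fun u v =>
  match u, v with
  | inl x, inl y => adj x y
  | inr x, inr y => adj x y
  | _, _ => true
  end.
Lemma gjoin_sym : symmetric gjoin_adj.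
Proof. by move=> [x|x] [y|y] //=; apply: adj_sym. Qed.
Lemma gjoin_irr : irreflexive gjoin_adj.
Proof. by move=> [x|x] /=; apply: adj_irr. Qed.
Definition gjoin := SGraph gjoin_sym gjoin_irr.
End Join.

(* Of order n only when k <= n, since n - k is truncated. *)
Definition S_graph (n k : nat) : sgraph :=
  gjoin (complete k) (compl (complete (n - k))).

(* The added edge joins the vertices numbered 0 and 1 of the independent set;
   by symmetry the choice is immaterial. It exists only when k + 2 <= n. *)
Section SPlus.
Variables n k : nat.
Definition extra_edge : rel (S_graph n k) := fun u v =>
  match u, v with
  | inr x, inr y => ((val x == 0) && (val y == 1)) || ((val x == 1) && (val y == 0))
  | _, _ => false
  end.
Definition S_plus_adj : rel (S_graph n k) := fun u v => adj u v || extra_edge u v.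
Lemma S_plus_sym : symmetric S_plus_adj.
Proof.
move=> u v; rewrite /S_plus_adj adj_sym; congr (_ || _).
by case: u v => [x|x] [y|y] //=; rewrite orbC; congr (_ || _); rewrite andbC.
Qed.
Lemma S_plus_irr : irreflexive S_plus_adj.
Proof.
move=> u; rewrite /S_plus_adj adj_irr.
by case: u => [x|x] //=; case: (val x) => [|[]].
Qed.
Definition S_plus := SGraph S_plus_sym S_plus_irr.
End SPlus.

(* The vertices inl _ are the s leaves of the star, and the vertices inr _ those
   of the path P_t in order; inr 0 is also the center of the star. This is
   B_{s,t} for t >= 1. *)
Section Broom.
Variables s t : nat.
Definition broom_adj : rel ('I_s + 'I_t)%type := fun u v =>
  match u, v with
  | inl _, inl _ => false
  | inl _, inr j => val j == 0
  | inr i, inl _ => val i == 0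
  | inr i, inr j => (val j == (val i).+1) || (val i == (val j).+1)
  end.
Lemma broom_sym : symmetric broom_adj.
Proof. by move=> [x|x] [y|y] //=; rewrite orbC. Qed.
Lemma broom_irr : irreflexive broom_adj.
Proof. by move=> [x|x] //=; rewrite orbb ltn_eqF. Qed.
Definition broom := SGraph broom_sym broom_irr.
End Broom.

(* Main.v *)
Require Import Defs.
From mathcomp Require Import all_boot.
From mathcomp Require Import zify.

Set Implicit Arguments.
Unset Strict Implicit.
Unset Printing Implicit Defensive.

(** The number of edges of S_{n,k}^+ is read off its degree sum.  For the
    embedding, let G be a connected graph on n vertices, n large, without the
    broom B_{2,2k+1}.  The broom is there as soon as a vertex c starts a path on
    2k+1 vertices and has two neighbours off that path
    ([few_nbrs_off_path]).  It suffices to show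
    2 e(G) <= 2kn - k(k+1) ([num_edges_broom_free]).

    If e(G) exceeds that bound then e(G) > (2k-1)n/2, and the Erdos-Gallai
    theorem on cycles ([erdos_gallai_cycle]) gives a cycle s with at least 2k
    vertices.  By connectivity every vertex starts a path that runs into s and
    then all the way around it, so s forces nearly all degrees to be small.

    If s has more than 4k vertices, every vertex v starts a path on more than 4k
    vertices.  All but at most one of the neighbours of v are among the next 2k vertices
    of that path; jumping from v to the last such neighbour yields a second
    path, with an almost disjoint set of next 2k vertices that again contains
    all but at most one neighbour of v.  Hence v has degree at most 3
    ([start_very_long_path_deg]) and e(G) <= 3n/2, which is too small.

    Otherwise s has bounded length.  A vertex off s has at most two neighbours
    off s, and at most one if it is adjacent to s ([outer_nbrs],
    [outer_nbrs_attached]).  Call a vertex of s big when its degree is at least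
    2k+2: a big vertex cannot start a path on 2k+1 vertices, so there is none
    when s is longer than 2k, and no two are consecutive when s has exactly 2k
    vertices.  Hence at most k vertices are big ([card_big]).  Up to a constant,
    2 e(G) is then the sum over the vertices y off s of twice the number of big
    neighbours of y plus the number of its neighbours off s.  A term of this sum
    is at most 2k-1 unless y is adjacent to k big vertices, so for large n there
    must be k+3 vertices adjacent to all the big vertices, of which there are
    exactly k.  With this K_{k,k+3} in G, any edge that avoids the big vertices
    would complete a zigzag between its two sides to a broom
    ([no_outer_edge]); so every edge meets the set of k big vertices, which
    gives e(G) <= k(k-1)/2 + k(n-k), as wanted. *)

(** * Degrees and edge counts *)

Section Degrees.

Variable G : sgraph.
Implicit Types (x y : G) (A B : {set G}).

Definition nbrs x : {set G} := [set y | adj x y].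

Lemma card_nbrsI x A : #|nbrs x :&: A| = \sum_(y in A) adj x y.
Proof.
rewrite -sum1_card big_mkcond [RHS]big_mkcond; apply: eq_bigr => y _.
by rewrite !inE; case: (adj x y); case: (y \in A).
Qed.

Lemma sum_nbrsI_sym A B :
  \sum_(x in A) #|nbrs x :&: B| = \sum_(y in B) #|nbrs y :&: A|.
Proof.
under eq_bigr do rewrite card_nbrsI.
under [RHS]eq_bigr do rewrite card_nbrsI.
by rewrite exchange_big; do 2!apply: eq_bigr => ? _; rewrite adj_sym.
Qed.

Lemma handshake : 2 * num_edges G = \sum_(x : G) #|nbrs x|.
Proof.
transitivity #|[set p : G * G | adj p.1 p.2]|; last first.
  under [RHS]eq_bigr do rewrite -[nbrs _]setIT card_nbrsI.
  rewrite pair_big -sum1_card big_mkcond /=.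
  under [RHS]eq_bigl do rewrite inE.
  by apply: eq_bigr => -[x y] _; rewrite inE /=; case: adj.
rewrite -sum1_card (partition_big (fun p => [set p.1; p.2]) (mem (edges G))) /=.
  rewrite mulnC -sum_nat_const; apply: eq_bigr => A.
  rewrite inE => /existsP[x /existsP[y /andP[xy /eqP->]]].
  have nxy : x != y by apply: contraTneq xy => ->; rewrite adj_irr.
  have <- : #|[set (x, y); (y, x)]| = 2 by rewrite cards2 xpair_eqE (negPf nxy).
  rewrite -sum1_card; apply: eq_bigl => -[a b]; rewrite !inE !xpair_eqE /=.
  apply/idP/andP => [/orP[]/andP[/eqP-> /eqP->]|[ab /eqP e]].
  - by [].
  - by rewrite adj_sym setUC.
  have : a \in [set x; y] by rewrite -e !inE eqxx.
  have : b \in [set x; y] by rewrite -e !inE eqxx orbT.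
  rewrite !inE => /orP[]/eqP eb /orP[]/eqP ea; subst; rewrite ?eqxx ?orbT //.
    by rewrite adj_irr in ab.
  by rewrite adj_irr in ab.
move=> [a b]; rewrite !inE /= => ab.
by apply/existsP; exists a; apply/existsP; exists b; rewrite ab eqxx.
Qed.

(** The edges all meet K, so their number is largest when K is complete and joined
    to everything else; the bound is k(k-1)/2 + k(n-k) edges, doubled and freed of
    subtractions. *)
Lemma num_edges_outer_independent (K : {set G}) k : #|K| = k ->
  (forall u v : G, u \notin K -> v \notin K -> ~~ adj u v) ->
  2 * num_edges G + k + k * k <= 2 * k * #|G|.
Proof.
move=> cK ind; rewrite handshake (bigID (mem K)) /=.
have H1 : \sum_(x in K) #|nbrs x| <= k * #|G|.-1.
  rewrite -cK -sum_nat_const; apply: leq_sum => x _.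
  rewrite -(cardsC1 x) subset_leq_card //; apply/subsetP => y; rewrite !inE.
  by apply: contraTneq => ->; rewrite adj_irr.
have H2 : \sum_(x | x \notin K) #|nbrs x| <= #|~: K| * k.
  rewrite -sum_nat_const (eq_bigl (mem (~: K))) => [|x]; last by rewrite !inE.
  apply: leq_sum => x; rewrite !inE => xK; rewrite -cK subset_leq_card //.
  apply/subsetP => y; rewrite inE => xy; apply: contraLR xy => yK.
  exact: ind.
have := cardsC K; rewrite cK => cG; have : #|G| = k + #|~: K| by [].
move: H1 H2; set a := \sum_(_ in _) _; set b := \sum_(_ | _) _.
set n := #|G|; set m := #|_| => H1 H2 en.
have : k * n.-1 + k = k * n.
  by case: (k) en => // k' en; rewrite addnC -mulnS prednK // en.
have : 2 * k * n = k * n + k * k + m * k by rewrite en; lia.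
lia.
Qed.

End Degrees.

Lemma double_bin2 k : ((k * (k + 1)) %/ 2).*2 = k * (k + 1).
Proof. by rewrite divn2 halfK oddM oddD /=; case: odd; rewrite subn0. Qed.

Lemma num_edges_S_plus n k : 0 < k -> k + 2 <= n ->
  num_edges (S_plus n k) = k * n - (k * (k + 1)) %/ 2 + 1.
Proof.
move=> k0 kn; have H := handshake (S_plus n k).
rewrite big_sumType /= in H.
have Hl (i : 'I_k) : #|nbrs (inl i : S_plus n k)| = n.-1.
  have -> : nbrs (inl i : S_plus n k) = [set~ inl i].
    apply/setP => -[j|j]; rewrite !inE /adj /= /S_plus_adj /=.
      by rewrite orbF /complete_adj eq_sym; congr (~~ _); apply/eqP/eqP => [->|[]].
    by [].
  by rewrite cardsC1 card_sum !card_ord; lia.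
have Hr (j : 'I_(n - k)) : #|nbrs (inr j : S_plus n k)| = k + (j < 2).
  rewrite -sum1_card big_sumType /=; congr (_ + _).
    rewrite (eq_bigl xpredT) ?sum1_card ?card_ord // => i.
    by rewrite !inE.
  rewrite sum1_card.
  case: ltnP => j2.
    have h : 1 - j < n - k by lia.
    transitivity #|pred1 (Ordinal h)|; last by rewrite card1.
    apply: eq_card => i; rewrite -[LHS]/(inr i \in nbrs (inr j : S_plus n k)).
    rewrite !inE /adj /= /S_plus_adj /= /compl_adj /= /complete_adj negbK andNb /= -val_eqE /=.
    by case: (val j) j2 => [|[|[]]] //= _; case: (val i) => [|[|]].
  apply: eq_card0 => i; rewrite -[LHS]/(inr i \in nbrs (inr j : S_plus n k)).
  rewrite !inE /adj /= /S_plus_adj /= /compl_adj /= /complete_adj negbK andNb /=.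
  by case: (val j) j2 => [|[|]].
move: H; under eq_bigr do rewrite Hl.
under [X in _ = _ + X]eq_bigr do rewrite Hr.
rewrite big_split /= !sum_nat_const !card_ord.
have -> : \sum_(i < n - k) (i < 2) = 2.
  rewrite (_ : n - k = (n - k - 2).+2); last lia.
  by rewrite !big_ord_recl /= big1.
have := double_bin2 k; set q := _ %/ 2; rewrite -addnn => hq H.
have {}hq : q + q <= k * n by rewrite hq leq_mul2l; lia.
have := double_bin2 k; rewrite -/q -addnn; nia.
Qed.

(** * Long cycles in dense graphs *)

(** Extremal choices of a path below are optimal choices among the duplicate-free
    sequences with some property; these are finitely many, as their lengths are
    bounded by the number of vertices. *)
Lemma ex_max_uniq_seq (T : finType) (A : pred (seq T)) (f : seq T -> nat) b :
  (forall s, A s -> uniq s) -> (forall s, A s -> f s <= b) ->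
  (exists s, A s) -> exists2 s, A s & forall s', A s' -> f s' <= f s.
Proof.
move=> Auniq Ab [s0 As0].
pose P m := [exists n : 'I_#|T|.+1, [exists t : n.-tuple T, A t && (f t == m)]].
have PA s : A s -> P (f s).
  move=> As; have hs : size s < #|T|.+1 by rewrite ltnS -(card_uniqP (Auniq s As)) max_card.
  by apply/existsP; exists (Ordinal hs); apply/existsP; exists (in_tuple s); rewrite As eqxx.
have Pb m : P m -> m <= b.
  by case/existsP=> n /existsP[t /andP[At /eqP<-]]; apply: Ab.
case: (ex_maxnP (ex_intro P _ (PA _ As0)) Pb) => m.
case/existsP=> n /existsP[t /andP[At /eqP<-]] fmax.
by exists t => // s' As'; apply/fmax/PA.
Qed.

Section ErdosGallai.

Variable G : sgraph.
Implicit Types (x y : G) (H S : {set G}).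

Lemma chord_cycle x p i : path (@adj G) x p -> uniq (x :: p) ->
  i < size p -> adj x (nth x p i) ->
  exists s, [/\ cycle (@adj G) s, uniq s & size s = i.+2].
Proof.
move=> xp up ip xi; exists (take i.+2 (x :: p)); rewrite take_uniq //.
rewrite size_takel //= rcons_path take_path //=.
by rewrite (take_nth x) // last_rcons adj_sym.
Qed.

Lemma sum_nbrs_remove H S : S \subset H ->
  \sum_(x in H) #|nbrs x :&: H| =
  \sum_(x in H :\: S) #|nbrs x :&: (H :\: S)|
  + \sum_(x in S) (#|nbrs x :&: H| + #|nbrs x :&: (H :\: S)|).
Proof.
move=> sSH; rewrite big_split /= [X in _ = _ + (_ + X)]sum_nbrsI_sym.
rewrite (big_setID S) /= (setIidPr sSH) addnA addnAC -[RHS]addnC; congr (_ + _).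
rewrite -big_split /=; apply: eq_bigr => x _.
rewrite addnC -(cardsID S (nbrs x :&: H)) -setIA (setIidPr sSH).
by rewrite setIDA.
Qed.

(** Posa rotation: when x is adjacent to the vertex in position i+1 of a path
    starting at x, reversing the initial segment of positions 0, ..., i gives a
    path on the same vertices that starts at the vertex z in position i.  Any
    initial segment containing position i is only permuted, hence the last
    clause. *)
Lemma rotate_path x p i : path (@adj G) x p -> uniq (x :: p) -> i < size p ->
  adj x (nth x p i) ->
  let q := rev (take i (x :: p)) ++ drop i p in
  let z := nth x (x :: p) i in
  [/\ path (@adj G) z q, uniq (z :: q), perm_eq (z :: q) (x :: p)
    & forall c, i < c -> {subset take c (z :: q) <= take c (x :: p)}].
Proof.
move=> xp up ip xi q z.
have zq : z :: q = rev (take i.+1 (x :: p)) ++ drop i p.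
  by rewrite (take_nth x) ?rev_rcons //= ltnW.
have pq : perm_eq (z :: q) (x :: p).
  rewrite zq -[drop i p]/(drop i.+1 (x :: p)).
  by rewrite -[X in perm_eq _ X](cat_take_drop i.+1) perm_cat2r perm_rev.
split=> //; last 1 first.
- move=> c ic y; rewrite zq take_cat size_rev size_takel; last exact: ltnW.
  by rewrite ltnNge ic /= -[in X in _ -> X](subnKC ic) takeD !mem_cat mem_rev.
- rewrite -[path _ _ _]/(sorted (@adj G) (z :: q)) zq.
  rewrite rev_cons cat_rcons sorted_cat_cons -rev_cons rev_sorted.
  under eq_sorted do rewrite adj_sym.
  rewrite /= take_path //= (drop_nth x) //= xi /=.
  by have := drop_sorted i (path_sorted xp); rewrite (drop_nth x).
by rewrite (perm_uniq pq).
Qed.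

(** The Erdos-Gallai theorem for the subgraph induced on H, by induction on H.
    Take a longest path in H whose first vertex x has maximal degree d among the
    first vertices of longest paths, and let S be the set of the d first vertices
    of its rotations.  If no cycle is longer than c, then the neighbours of the
    members of S all lie in the set Z of the c first vertices of the path.
    Counting edges inside S twice and the others from both ends, the edges
    meeting S contribute at most d * (d + (|Z| - d)) <= c * d to the degree sum,
    so S can be removed. *)
Lemma erdos_gallai_cycle c H :
  c * #|H| < \sum_(x in H) #|nbrs x :&: H| ->
  exists s : seq G, [/\ cycle (@adj G) s, uniq s & c < size s].
Proof.
have [m] := ubnP #|H|; elim: m H => // m IH H /ltnSE Hm cH.
(* The density hypothesis survives the removal of a set meeting few edges. *)
have removeS S : S \subset H -> S != set0 ->
    \sum_(x in S) (#|nbrs x :&: H| + #|nbrs x :&: (H :\: S)|) <= c * #|S| ->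
    exists s : seq G, [/\ cycle (@adj G) s, uniq s & c < size s].
  move=> sSH; rewrite -card_gt0 => S0 le; apply: (IH (H :\: S)).
    by have := cardsID S H; rewrite (setIidPr sSH); lia.
  by move: cH; rewrite (sum_nbrs_remove sSH); have := cardsID S H; rewrite (setIidPr sSH); nia.
have [x0 x0H] : exists x0, x0 \in H.
  by apply/set0Pn; apply: contraTneq cH => ->; rewrite big_set0.
(* Longest paths come first; ties are broken by the degree of the first vertex,
   whence the weight #|G|.+1, larger than any degree. *)
pose A s := [&& s != [::], sorted (@adj G) s, uniq s & all (mem H) s].
pose f s := size s * #|G|.+1 + #|nbrs (head x0 s) :&: H|.
have [|||s As smax] := @ex_max_uniq_seq G A f (#|G| * #|G|.+1 + #|G|).
- by move=> s /and4P[].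
- move=> s /and4P[_ _ us _]; rewrite leq_add ?max_card // leq_mul2r.
  by rewrite -(card_uniqP us) max_card orbT.
- by exists [:: x0]; rewrite /A /= x0H.
case: s As smax => // x p /and4P[_ /= xp up /andP[xH pH]] smax.
have pHs : {subset p <= H} by move=> y /(allP pH).
have longest s : A s -> size s <= size (x :: p).
  move=> As; rewrite leqNgt; apply/negP => lt.
  have := smax s As; rewrite /f leqNgt => /negP; apply.
  have : #|nbrs x :&: H| <= #|G| by exact: max_card.
  have := leq_mul lt (leqnn #|G|.+1).
  by rewrite [_.+1 * _]mulSn /=; lia.
set d := #|nbrs x :&: H|.
have nb_in z q : perm_eq (z :: q) (x :: p) -> path (@adj G) z q ->
    forall w, w \in nbrs z :&: H -> w \in q.
  move=> pq zq w; rewrite !inE => /andP[zw wH]; apply: contraT => wq.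
  have/longest : A (w :: z :: q).
    rewrite /A /= adj_sym zw zq wH -[_ && all _ _]/(all (mem H) (z :: q)).
    rewrite -[_ && uniq q]/(uniq (z :: q)) (perm_uniq pq) (perm_all _ pq) /= up xH pH.
    by rewrite inE negb_or wq !andbT; apply: contraTneq zw => ->; rewrite adj_irr.
  by rewrite -[size (w :: _)]/(size (z :: q)).+1 (perm_size pq) ltnn.
pose I := [seq i <- iota 0 (size p) | adj x (nth x p i)].
have II i : (i \in I) = (i < size p) && adj x (nth x p i).
  by rewrite mem_filter mem_iota /= andbC.
have uI : uniq I by rewrite filter_uniq ?iota_uniq.
pose S := [set z in [seq nth x (x :: p) i | i <- I]].
have cardS : #|S| = d.
  rewrite /d (_ : nbrs x :&: H = [set z in [seq nth x p i | i <- I]]).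
    rewrite !cardsE !(card_uniqP _) ?size_map // map_inj_in_uniq // => i j.
      rewrite !II => /andP[ip _] /andP[jp _] /eqP.
      by rewrite nth_uniq // => [/eqP //|]; case/andP: up.
    by rewrite !II => /andP[ip _] /andP[jp _] /eqP; rewrite nth_uniq /= ?ltnS 1?ltnW // => /eqP.
  apply/setP => w; rewrite inE; apply/idP/mapP => [wN|[i]].
    have wp := nb_in x p (perm_refl _) xp w wN.
    by exists (index w p); rewrite ?II ?index_mem ?nth_index // wp; case/setIP: wN; rewrite inE.
  by rewrite II => /andP[ip xi] ->; rewrite !inE xi pHs // mem_nth.
have SH : S \subset H.
  apply/subsetP => z; rewrite inE => /mapP[i]; rewrite II => /andP[ip _] ->.
  have : nth x (x :: p) i \in x :: p by rewrite mem_nth //= ltnS ltnW.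
  by rewrite inE => /orP[/eqP->|/pHs].
have [d0|d0] := posnP d.
  apply: (removeS [set x]); rewrite ?sub1set //.
    by apply/set0Pn; exists x; rewrite inE.
  rewrite big_set1 -/d d0 (_ : #|_| = 0) //; apply/eqP.
  by rewrite -leqn0 -d0 subset_leq_card // setIS // subsetDl.
(* A neighbour of x too far along the path closes a long cycle. *)
have [/hasP[i iI ci]|/hasPn Ic] := boolP (has (fun i => c <= i.+1) I).
  move: iI; rewrite II => /andP[ip xi].
  have [s [cs us sz]] := chord_cycle xp up ip xi.
  by exists s; rewrite sz.
have {}Ic i : i \in I -> i.+1 < c by move/Ic; rewrite -ltnNge.
pose Z := [set z in take c (x :: p)].
(* The same applies to the rotated paths, as they are also longest. *)
have [allZ|] := boolP [forall z in S, nbrs z :&: H \subset Z]; last first.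
  case/forall_inPn => z; rewrite inE => /mapP[i]; rewrite II => /andP[ip xi] ->.
  have [] := rotate_path xp up ip xi; set q := _ ++ _; set u := nth _ _ _.
  move=> uq Uq pq qZ /subsetPn[w wN wZ].
  have wq := nb_in _ _ pq uq _ wN.
  pose j := index w q; have wj : nth u q j = w by apply: nth_index.
  have jq : j < size q by rewrite index_mem.
  have [|s [cs us sz]] := chord_cycle uq Uq jq.
    by rewrite wj; case/setIP: wN; rewrite inE.
  exists s; rewrite sz; split=> //; rewrite ltnNge; apply: contra wZ => jc.
  rewrite inE; apply: (qZ c (ltnW (Ic _ _))); first by rewrite II ip.
  rewrite -wj -[nth u q j]/(nth u (u :: q) j.+1) -(nth_take u jc).
  by rewrite mem_nth // size_take_min leq_min jc /= ltnS.
apply: (removeS S) => //; first by rewrite -card_gt0 cardS.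
have SZ : S \subset Z.
  apply/subsetP => z; rewrite !inE => /mapP[i iI ->].
  rewrite -(nth_take x (ltnW (Ic i iI))) mem_nth // size_take_min leq_min ltnW ?Ic //=.
  by move: iI; rewrite II ltnS => /andP[/ltnW].
have cZ : #|Z| <= c by rewrite cardsE (leq_trans (card_size _)) // size_take; case: ltnP.
rewrite mulnC -sum_nat_const; apply: leq_sum => z zS.
have : #|nbrs z :&: (H :\: S)| <= #|Z :\: S|.
  by rewrite setIDA subset_leq_card // setSD // (forall_inP allZ).
have : #|nbrs z :&: H| <= d.
  move: zS; rewrite inE => /mapP[i]; rewrite II => /andP[ip xi] ->.
  have [] := rotate_path xp up ip xi; set q := _ ++ _; set u := nth _ _ _.
  move=> uq Uq pq _.
  have /smax : A (u :: q).
    by rewrite /A (perm_uniq pq) (perm_all _ pq) /= uq up xH pH.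
  by rewrite /f (perm_size pq) leq_add2l.
have := cardsID S Z; rewrite (setIidPr SZ); lia.
Qed.

End ErdosGallai.

(** * Paths and cycles in connected graphs *)

Lemma split_last_has (T : eqType) (a : pred T) (s : seq T) : has a s ->
  exists s1 x s2, [/\ s = s1 ++ x :: s2, a x & ~~ has a s2].
Proof.
elim: s => //= y s IH; have [/IH[s1 [x [s2 [-> ax n]]]] _|n] := boolP (has a s).
  by exists (y :: s1), x, s2.
by rewrite orbF => ay; exists [::], y, s.
Qed.

Section ConnectedGraphs.

Variable G : sgraph.
Implicit Types (x y z v w : G) (p q s : seq G).

Lemma cycle_path_from s x : cycle (@adj G) s -> uniq s -> x \in s ->
  exists p, [/\ path (@adj G) x p, uniq (x :: p), (size p).+1 = size s
    & {subset p <= s}].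
Proof.
move=> cs us /rot_to[i p e]; exists p.
rewrite -[(size p).+1]/(size (x :: p)) -e rot_uniq size_rot; split=> //.
  have : cycle (@adj G) (x :: p) by rewrite -e rot_cycle.
  by rewrite /= rcons_path => /andP[].
by move=> y yp; rewrite -(mem_rot i) e inE yp orbT.
Qed.

(** The path is extended at its start, through one vertex of ws and one of ks at a
    time, until ks is used up. *)
Lemma alternating_path (ks ws : seq G) x q :
  path (@adj G) x q -> size ws = size ks ->
  (forall a b, a \in x :: ks -> b \in ws -> adj a b) ->
  exists c p, [/\ path (@adj G) c p, perm_eq (c :: p) (x :: q ++ ks ++ ws)
    & c \in x :: ks].
Proof.
elim: ks ws x q => [|a ks IH] [|b ws] x q //= xq.
  by move=> _ _; exists x, q; rewrite !cats0 mem_head.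
case=> sz adjs.
have [||c [p [cp pp cks]]] := IH ws a (b :: x :: q) _ sz.
- by rewrite /= xq adjs ?[adj b x]adj_sym ?adjs // !inE eqxx ?orbT.
- by move=> a' b' ha hb; apply: adjs; rewrite inE ?ha ?hb orbT.
exists c, p; split=> //; last by rewrite inE cks orbT.
apply: (perm_trans pp); apply/permP => P /=; rewrite !count_cat /= !count_cat /=; lia.
Qed.

Hypothesis G_conn : connected G.

(** A shortest path from v to C has no shortcut: it meets C only at its end, and
    only its second vertex is adjacent to v. *)
Lemma induced_path_to (C : {set G}) v : C != set0 -> v \notin C ->
  exists q x, [/\ path (@adj G) v (rcons q x), uniq (v :: rcons q x), x \in C,
    [disjoint q & C] & forall w, w \in behead (rcons q x) -> ~~ adj v w].
Proof.
move=> /set0Pn[x0 x0C] vC.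
pose A p := [&& path (@adj G) v p, uniq (v :: p) & last v p \in C].
have [||| p /and3P[vp up lp] pmin] := @ex_max_uniq_seq G A (fun p => #|G| - size p) #|G|.
- by move=> p /and3P[_ /andP[]].
- by move=> p _; apply: leq_subr.
- have /connectP[p vp ex0] := G_conn v x0.
  case/shortenP: vp ex0 => p' vp' up' _ ex0.
  by exists p'; rewrite /A vp' up' -ex0.
have shortest p' : A p' -> size p <= size p'.
  move=> Ap'; have := pmin _ Ap'.
  have : size p <= #|G| by rewrite -(card_uniqP _) ?max_card //; case/andP: up.
  have : size p' <= #|G| by rewrite -(card_uniqP _) ?max_card //; case/and3P: Ap' => _ /andP[].
  by lia.
have dvw w : w \in behead p -> ~~ adj v w.
  case: p vp up lp {pmin} shortest => //= y r /andP[_ yr] up lr shortest wr.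
  apply/negP => vw; case/splitPr: wr yr up lr shortest => r1 r2.
  rewrite cat_path last_cat /= => /and3P[_ _ wr2] /and3P[vr _ ur] lr /(_ (w :: r2)).
  have -> : A (w :: r2).
    move: vr ur; rewrite /A /= vw wr2 lr !inE mem_cat !inE cat_uniq /= !negb_or.
    by case/and4P=> _ _ -> -> /and3P[_ _ /andP[-> ->]].
  by rewrite size_cat /=; lia.
case/lastP: p => [|q x] in vp up lp pmin shortest dvw *.
  by rewrite (negPf vC) in lp.
rewrite last_rcons in lp; exists q, x; split => //.
rewrite disjoint_has; apply/hasPn => w wq; apply/negP => wC.
case/splitPr: wq vp up shortest {pmin dvw} => q1 q2.
rewrite -cat_rcons rcons_cat cat_path -cat_cons cat_uniq => /andP[vq _] /andP[uq _].
move=> /(_ (rcons q1 w)); rewrite /A vq uq last_rcons wC => /(_ isT).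
by rewrite size_cat !size_rcons; lia.
Qed.

(** Otherwise the endpoints of the edges avoiding K would form a union of connected
    components disjoint from K. *)
Lemma outer_edge_near (K : {set G}) u v : K != set0 -> u \notin K -> v \notin K ->
  adj u v -> exists x y z, [/\ x \in K, y \notin K, z \notin K, adj x y & adj y z].
Proof.
move=> /set0Pn[x0 x0K] uK vK uv.
pose U := [set y | (y \notin K) && [exists z, (z \notin K) && adj y z]].
have uU : u \in U by rewrite inE uK; apply/existsP; exists v; rewrite vK.
have [/existsP[y /andP[yU /exists_inP[x xK xy]]]|noU] :=
    boolP [exists y, (y \in U) && [exists x in K, adj x y]].
  move: yU; rewrite inE => /andP[yK /existsP[z /andP[zK yz]]].
  by exists x, y, z.
have clU : closed (@adj G) (mem U).
  apply: intro_closed; first exact/sym_connect_sym/adj_sym.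
  move=> y z yz yU; move: (yU); rewrite !inE => /andP[yK _].
  have zK : z \notin K.
    apply: contra noU => zK; apply/existsP; exists y; rewrite yU.
    by apply/exists_inP; exists z; rewrite // adj_sym.
  by rewrite zK; apply/existsP; exists y; rewrite yK adj_sym.
by have := closed_connect clU (G_conn u x0); rewrite uU inE x0K.
Qed.

End ConnectedGraphs.

(** * Brooms and degrees *)

(** Containment of finite graphs is decidable, which justifies assuming the absence
    of brooms for a contradiction. *)
Lemma contains_dec (G H : sgraph) : decidable (contains G H).
Proof.
apply: (@decP _ [exists f : {ffun H -> G}, injectiveb f &&
  [forall x, forall y, adj x y ==> adj (f x) (f y)]]).
apply: (iffP existsP) => [[f /andP[/injectiveP fI fA]]|[f fI fA]].
  exists f => // x y xy.
  by have /forallP/(_ y)/implyP := forallP fA x; apply.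
exists (finfun f); apply/andP; split.
  by apply/injectiveP => x y; rewrite !ffunE; apply: fI.
by apply/forallP => x; apply/forallP => y; rewrite !ffunE; apply/implyP/fA.
Qed.

Lemma broom_of_path (G : sgraph) (c : G) p a b :
  path (@adj G) c p -> uniq (c :: p) -> adj c a -> adj c b -> a != b ->
  a \notin p -> b \notin p -> contains G (broom 2 (size p).+1).
Proof.
move=> cp up ca cb ab ap bp.
have nc w : adj c w -> w != c by apply: contraTneq => ->; rewrite adj_irr.
pose lf (i : 'I_2) := if i == ord0 then a else b.
have lfP i : lf i \notin c :: p.
  by rewrite /lf inE negb_or; case: ifP => _; rewrite ?ap ?bp ?nc.
have clf i : adj c (lf i) by rewrite /lf; case: ifP.
have pI (i j : 'I_(size p).+1) : nth c (c :: p) i = nth c (c :: p) j -> i = j.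
  by move=> /eqP; rewrite nth_uniq // => /eqP/val_inj.
pose f (u : broom 2 (size p).+1) : G :=
  match u with inl i => lf i | inr j => nth c (c :: p) j end.
exists f.
  move=> [i|i] [j|j] //= e.
  - congr inl; apply/val_inj; move: e ab; rewrite /lf -!val_eqE /=.
    by case: i j => [[|[|]]//= ?] [[|[|]]//= ?] => [->|<-]; rewrite ?eqxx.
  - by have := lfP i; rewrite e mem_nth.
  - by have := lfP j; rewrite -e mem_nth.
  - by congr inr; apply: pI.
have step (i j : 'I_(size p).+1) : val j == (val i).+1 ->
    adj (nth c (c :: p) i) (nth c (c :: p) j).
  move/eqP=> e; have := ltn_ord j; rewrite e ltnS /= => ip.
  by rewrite (pathP c cp).
move=> u v; rewrite -[adj u v]/(broom_adj u v); case: u v => [i|i] [j|j] //=.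
- by move/eqP=> ->; rewrite adj_sym clf.
- by move/eqP=> ->; rewrite clf.
by case/orP=> /step //; rewrite adj_sym.
Qed.

Section BroomFree.

Variables (G : sgraph) (k : nat).
Hypothesis k2 : 2 <= k.
Hypothesis G_conn : connected G.
Hypothesis broom_free : ~ contains G (broom 2 (2 * k + 1)).

Implicit Types (x y z v w : G) (p q s : seq G).

(** The broom criterion: two neighbours of c off the path would be the leaves of a
    broom with centre c.  Only the 2k vertices after c matter, so neighbours of c
    further along the path count as being off it. *)
Lemma few_nbrs_off_path c p : path (@adj G) c p -> uniq (c :: p) ->
  2 * k <= size p -> #|nbrs c :\: [set w in take (2 * k) p]| <= 1.
Proof.
move=> cp up kp; rewrite leqNgt; apply/negP => /card_gt1P[a [b [aN bN ab]]].
apply: broom_free; rewrite addn1 -(size_takel kp).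
move: aN bN; rewrite !inE => /andP[ap ca] /andP[bp cb].
apply: (broom_of_path _ _ ca cb ab ap bp); first exact: take_path.
exact: (take_uniq (2 * k).+1 up).
Qed.

Lemma start_long_path_deg c p : path (@adj G) c p -> uniq (c :: p) ->
  2 * k <= size p -> #|nbrs c| <= (2 * k).+1.
Proof.
move=> cp up kp; have := few_nbrs_off_path cp up kp.
rewrite -(cardsID [set w in take (2 * k) p] (nbrs c)).
have := subset_leq_card (subsetIr (nbrs c) [set w in take (2 * k) p]).
have : #|[set w in take (2 * k) p]| <= 2 * k.
  by rewrite cardsE (leq_trans (card_size _)) // size_takel.
lia.
Qed.

(** Let z be the last neighbour of c among the next 2k vertices of the path.
    Skipping from c to z gives a second path, whose next 2k vertices meet those of
    the first path in z and in vertices beyond z, which are not adjacent to c.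
    Each of the two stretches misses at most one neighbour of c. *)
Lemma start_very_long_path_deg c p : path (@adj G) c p -> uniq (c :: p) ->
  4 * k <= size p -> #|nbrs c| <= 3.
Proof.
move=> cp up kp; have kp' : 2 * k <= size p by lia.
have few1 := few_nbrs_off_path cp up kp'.
have : has (adj c) (take (2 * k) p).
  case: p cp kp {up kp' few1} => [|x p] /=; first by lia.
  by case/andP=> cx _ _; rewrite (_ : 2 * k = (2 * k).-1.+1) /= ?cx //; lia.
case/split_last_has => s1 [z [s2 [e cz ns2]]].
pose d := drop (2 * k) p.
have ep : p = s1 ++ z :: s2 ++ d by rewrite -cat_cons catA -e cat_take_drop.
have dk : 2 * k <= size d by rewrite size_drop; lia.
clearbody d; set W := take (2 * k) (z :: s2 ++ d).
have few2 : #|nbrs c :\: [set w in W]| <= 1.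
  apply: few_nbrs_off_path.
  - by move: cp; rewrite ep cat_path /= cz => /and3P[_ _ ->].
  - move: up; rewrite ep [uniq _]/= mem_cat negb_or cat_uniq.
    by case/andP=> /andP[_ cz'] /and3P[_ _ uz]; rewrite cons_uniq cz' uz.
  - by rewrite /= size_cat; lia.
(* z is the only neighbour of c that both stretches can contain. *)
have sub : nbrs c \subset (nbrs c :\: [set w in take (2 * k) p])
    :|: ((nbrs c :\: [set w in W]) :|: [set z]).
  apply/subsetP => w; rewrite !inE => cw; rewrite cw !andbT -implybE -implybE.
  apply/implyP => wp; apply/implyP => wW; move: wp; rewrite e mem_cat inE => /or3P[ws1|//|ws2].
    have wq := mem_take wW.
    move: up => /=/andP[_]; rewrite ep cat_uniq => /and3P[_ /hasPn/(_ w wq)].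
    by rewrite /= ws1.
  by have /hasPn/(_ w ws2) := ns2; rewrite cw.
have := subset_leq_card sub.
have := (leq_card_setU (nbrs c :\: [set w in take (2 * k) p])
   ((nbrs c :\: [set w in W]) :|: [set z])).1.
have := (leq_card_setU (nbrs c :\: [set w in W]) [set z]).1.
rewrite cards1; lia.
Qed.

(** Connectivity moves the edge next to K: there is a path x, u, v with x in K and
    u, v outside K.  Prolonged at x by a zigzag through all of K and k-1 vertices
    of W, it is a path on 2k+1 vertices that starts in K, and the remaining
    vertices of W supply two more neighbours for its first vertex. *)
Lemma no_outer_edge (K W : {set G}) : #|K| = k -> k + 3 <= #|W| ->
  (forall x w, x \in K -> w \in W -> adj x w) ->
  forall u v, u \notin K -> v \notin K -> ~~ adj u v.
Proof.
move=> cK cW KW u0 v0 u0K v0K; apply/negP => /(outer_edge_near G_conn _ u0K v0K)[].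
  by rewrite -card_gt0 cK; lia.
move=> x [u [v [xK uK vK xu uv]]].
have WK w : w \in W -> w \notin K.
  by move=> wW; apply/negP => /KW/(_ wW); rewrite adj_irr.
pose ks := enum (K :\ x); pose ws := enum (W :\: [set u; v]).
have sks : size ks = k.-1 by rewrite -cardE; have := cardsD1 x K; rewrite xK cK; lia.
have sws : k.+1 <= size ws.
  rewrite -cardE; have := cardsID [set u; v] W.
  have := subset_leq_card (subsetIr W [set u; v]).
  have : #|[set u; v]| <= 2 by rewrite cards2; case: eqP.
  by lia.
have uws : uniq ws by apply: enum_uniq.
have wsW w : w \in ws -> w \in W by rewrite mem_enum => /setDP[].
have wsP w : w \in ws -> [&& w \notin K, w != u & w != v].
  by move=> ww; rewrite WK ?wsW //; move: ww; rewrite mem_enum !inE negb_or => /andP[].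
have ksK y : y \in x :: ks -> y \in K.
  by rewrite inE mem_enum => /orP[/eqP->|/setD1P[]].
have [||| c [p [cp pp cks]]] := @alternating_path G ks (take k.-1 ws) x [:: u; v].
- by rewrite /= xu uv.
- by rewrite size_takel //; lia.
- by move=> a b /ksK aK /mem_take/wsW; apply: KW.
have uniqp : uniq (c :: p).
  have uv' : u != v by apply: contraTneq uv => ->; rewrite adj_irr.
  have xK' y : y \notin K -> x != y by apply: contraNneq => <-.
  rewrite (perm_uniq pp) !cons_uniq cat_uniq enum_uniq take_uniq // !inE !mem_cat !negb_or.
  rewrite uv' !xK' // !mem_enum !inE eqxx (negPf uK) (negPf vK) !andbF /= andbT.
  have notin y : ~~ [&& y \notin K, y != u & y != v] -> y \notin take k.-1 ws.
    by apply: contra => /mem_take/wsP.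
  rewrite !notin ?xK ?eqxx ?andbF //=; apply/hasPn => w /mem_take/wsP/and3P[wK _ _].
  by apply: contra wK => wks; rewrite ksK // inE wks orbT.
have sp : size p = 2 * k.
  by have := perm_size pp; rewrite /= !size_cat sks size_takel; lia.
have := few_nbrs_off_path cp uniqp; rewrite sp take_oversize ?sp // => /(_ (leqnn _)).
rewrite leqNgt => /negP; apply.
have cd : 1 < #|[set w in drop k.-1 ws]|.
  by rewrite cardsE (card_uniqP _) ?drop_uniq // size_drop; lia.
apply: (leq_trans cd); apply: subset_leq_card; apply/subsetP => w.
rewrite inE => wd; have wW := wsW _ (mem_drop wd).
rewrite !inE KW ?ksK // andbT.
have : w \notin c :: p; last by rewrite inE negb_or => /andP[].
have /wsP/and3P[wK wu wv] := mem_drop wd.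
have wks : w \notin x :: ks by apply: contra wK => /ksK.
rewrite (perm_mem pp) -cat_cons !mem_cat !inE; move: wks; rewrite inE !negb_or => /andP[-> ->].
rewrite wu wv /=; move: uws; rewrite -{1}(cat_take_drop k.-1 ws) cat_uniq.
by case/and3P=> _ /hasPn/(_ w wd).
Qed.

(** * Consequences of a long cycle *)

Section LongCycle.

Variable s : seq G.
Hypotheses (s_cycle : cycle (@adj G) s) (s_uniq : uniq s).
Hypothesis s_size : 2 * k <= size s.

Lemma path_into_cycle v q x : path (@adj G) v (rcons q x) ->
  uniq (v :: rcons q x) -> v \notin s -> x \in s -> [disjoint q & s] ->
  exists r, [/\ path (@adj G) v (rcons q x ++ r), uniq (v :: rcons q x ++ r),
    size s <= size (rcons q x ++ r) & {subset r <= s}].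
Proof.
move=> vq uq vs xs qs; have [r [xr ur sr rs]] := cycle_path_from s_cycle s_uniq xs.
exists r; rewrite cat_path vq last_rcons xr size_cat size_rcons; split=> //; last by lia.
rewrite -cat_cons cat_uniq uq /=; move: ur => /= /andP[xr' ->]; rewrite andbT.
apply/hasPn => w wr; rewrite inE mem_rcons inE !negb_or.
have ws := rs _ wr; apply/and3P; split.
- by apply: contraNneq vs => <-.
- by apply: contraNneq xr' => <-.
by rewrite (disjointFl qs).
Qed.

Lemma outer_nbrs_attached v x : v \notin s -> x \in s -> adj v x ->
  #|nbrs v :\: [set w in s]| <= 1.
Proof.
move=> vs xs vx; have [|||r [vr ur sr rs]] := @path_into_cycle v [::] x _ _ vs xs.
- by rewrite /= vx.
- by rewrite /= inE andbT; apply: contraNneq vs => ->.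
- by rewrite disjoint_has.
apply: leq_trans (few_nbrs_off_path vr ur (leq_trans s_size sr)).
apply: subset_leq_card; apply: setDS; apply/subsetP => w; rewrite !inE.
by move/mem_take; rewrite /= inE => /orP[/eqP->|/rs].
Qed.

(** The path goes to the cycle along a shortest route and then around it, so it
    uses at most one neighbour of v off the cycle, the first vertex of q. *)
Lemma induced_path_into_cycle v : v \notin s ->
  exists q p, [/\ path (@adj G) v (q ++ p), uniq (v :: q ++ p),
    size s <= size (q ++ p), {subset p <= s}
    & forall w, w \in behead q -> ~~ adj v w].
Proof.
move=> vs; have [y ys] : exists y, y \in s.
  by case: (s) s_size => [|y t]; [rewrite /=; lia | exists y; rewrite mem_head].
have [||q [x [vq uq xC qC nv]]] := @induced_path_to G G_conn [set w in s] v.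
- by apply/set0Pn; exists y; rewrite inE.
- by rewrite inE.
have qs : [disjoint q & s].
  by rewrite -(eq_disjoint_r (A := [set w in s])) // => w; rewrite inE.
have xs : x \in s by rewrite inE in xC.
have [r [vr ur sr rs]] := path_into_cycle vq uq vs xs qs.
exists q, (x :: r); rewrite -cat_rcons; split=> // w.
  by rewrite inE => /orP[/eqP->|/rs].
case: (q) nv => //= h q' nv wq'.
by apply: nv; rewrite mem_rcons inE wq' orbT.
Qed.

Lemma outer_nbrs v : v \notin s -> #|nbrs v :\: [set w in s]| <= 2.
Proof.
move=> vs; have [q [p [vp up sp ps nv]]] := induced_path_into_cycle vs.
have few := few_nbrs_off_path vp up (leq_trans s_size sp).
set P := [set w in take _ _] in few; set C := [set w in s].
have sub : nbrs v :\: C \subset (nbrs v :\: P) :|: [set head v q].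
  apply/subsetP => w; rewrite !inE => /andP[ws vw]; rewrite vw andbT.
  have [/mem_take|//] := boolP (w \in take _ _).
  rewrite mem_cat (contraNF (ps _) ws) orbF.
  case: (q) nv => //= h q' nv; rewrite inE => /orP[->//|/nv].
  by rewrite vw.
have := subset_leq_card sub; have := (leq_card_setU (nbrs v :\: P) [set head v q]).1.
by rewrite cards1; lia.
Qed.

Lemma long_path_from v :
  exists p, [/\ path (@adj G) v p, uniq (v :: p) & size s <= (size p).+1].
Proof.
have [vs|vs] := boolP (v \in s).
  by have [p [vp up <- _]] := cycle_path_from s_cycle s_uniq vs; exists p.
have [q [p [vp up sp _ _]]] := induced_path_into_cycle vs.
by exists (q ++ p); split=> //; apply: leqW.
Qed.

Definition big : {set G} := [set x in s | (2 * k).+1 < #|nbrs x|].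

(** Going around the cycle from next s x, one ends at x, and the path can be
    prolonged by a neighbour of x off the cycle, as x has too many neighbours for
    the cycle to contain them all.  This makes 2k+1 vertices. *)
Lemma next_big x : size s = 2 * k -> x \in big -> next s x \notin big.
Proof.
move=> sk; rewrite !inE => /andP[xs bx].
apply/negP => /andP[_]; rewrite ltnNge => /negP; apply.
have [y yN] : exists y, y \in nbrs x :\: [set w in s].
  apply/set0Pn; rewrite -card_gt0.
  have := cardsID [set w in s] (nbrs x).
  have := subset_leq_card (subsetIr (nbrs x) [set w in s]).
  have : #|[set w in s]| <= 2 * k by rewrite cardsE -sk card_size.
  by lia.
move: yN; rewrite !inE => /andP[ys xy].
case/rot_to: (xs) => i p e.
case: p e => [|x' p] e.
  by have := size_rot i s; rewrite e sk /=; lia.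
have -> : next s x = x' by rewrite -(next_rot i) // e /= eqxx.
have : cycle (@adj G) (x :: x' :: p) by rewrite -e rot_cycle.
have : uniq (x :: x' :: p) by rewrite -e rot_uniq.
have inp z : z \in x :: x' :: p -> z != y.
  by rewrite -e mem_rot; apply: contraTneq => ->.
move=> up /= /andP[xx' x'p].
apply: (@start_long_path_deg x' (rcons (rcons p x) y)).
- by rewrite rcons_path last_rcons x'p.
- rewrite -!rcons_cons !rcons_uniq mem_rcons; rewrite cons_uniq in up.
  case/andP: up => -> ->; rewrite !andbT; apply/negP => /inp.
  by rewrite eqxx.
- by have := size_rot i s; rewrite e sk !size_rcons /=; lia.
Qed.

Lemma card_big : #|big| <= k.
Proof.
have [lt|eq] := ltnP (2 * k) (size s).
  rewrite (_ : big = set0) ?cards0 //; apply/setP => x; rewrite !inE.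
  apply/negP => /andP[xs]; rewrite ltnNge => /negP; apply.
  have [p [xp up sp _]] := cycle_path_from s_cycle s_uniq xs.
  by apply: (start_long_path_deg xp up); lia.
have sk : size s = 2 * k by apply/eqP; rewrite eqn_leq eq.
have inj : injective (next s) := can_inj (prev_next s_uniq).
have dis : [disjoint big & next s @: big].
  rewrite disjoint_sym disjoint_subset; apply/subsetP => _ /imsetP[x xB ->].
  by rewrite inE next_big.
have sub : big :|: next s @: big \subset [set w in s].
  apply/subsetP => x; rewrite in_setU => /orP[|/imsetP[y yB ->]]; rewrite !inE.
    by case/andP.
  by rewrite mem_next; move: yB; rewrite inE => /andP[].
have := subset_leq_card sub; rewrite cardsU disjoint_setI0 // cards0 subn0.
rewrite card_imset //.
have : #|[set w in s]| <= 2 * k by rewrite cardsE -sk card_size.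
by lia.
Qed.

(** Only the vertices y off the cycle matter, since the vertices of the cycle that
    are not big meet boundedly many edges.  Those y with k big neighbours are
    allowed an excess of 2 over the bound 2k-1.  The constant is 4k * k for the big
    neighbours of the vertices of the cycle, plus twice 4k * (2k+1) for the
    degrees of the vertices of the cycle that are not big. *)
Lemma num_edges_around_cycle : size s <= 4 * k ->
  2 * num_edges G <= (2 * k - 1) * #|G| + 2 * #|[set y | k <= #|nbrs y :&: big|]|
    + 4 * k * (5 * k + 2).
Proof.
move=> s4; set F := [set y | _]; set C := [set x in s]; set D := C :\: big.
have cC : #|C| <= 4 * k by rewrite cardsE (leq_trans (card_size _)).
have BC : big \subset C by apply/subsetP => x; rewrite !inE => /andP[].
have D_bound : \sum_(x in D) #|nbrs x| <= 4 * k * (2 * k).+1.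
  apply: (@leq_trans (\sum_(x in D) (2 * k).+1)).
    by apply: leq_sum => x; rewrite !inE => /andP[nb xs]; rewrite xs -leqNgt in nb.
  rewrite sum_nat_const leq_mul2r; apply/orP; right.
  by apply: leq_trans cC; rewrite subset_leq_card ?subsetDl.
have B_sum : \sum_(x in big) #|nbrs x| <= 4 * k * k + \sum_(y in ~: C) #|nbrs y :&: big|.
  under eq_bigr do rewrite -[nbrs _]setIT.
  rewrite sum_nbrsI_sym (bigID (mem C)) /= leq_add //; last first.
    by rewrite (eq_bigl (mem (~: C))) // => y; rewrite !inE.
  rewrite (eq_bigl (mem C)) => [|y]; last by rewrite in_setT.
  apply: (@leq_trans (\sum_(x in C) k)); last by rewrite sum_nat_const leq_mul2r cC orbT.
  by apply: leq_sum => x _; apply: leq_trans card_big; rewrite subset_leq_card ?subsetIr.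
have D_sum : \sum_(y in ~: C) #|nbrs y :&: D| <= 4 * k * (2 * k).+1.
  rewrite sum_nbrsI_sym; apply: leq_trans D_bound; apply: leq_sum => x _.
  by rewrite subset_leq_card ?subsetIl.
(* A vertex with a big neighbour has at most one neighbour off s, so k-1 big
   neighbours give at most 2(k-1) + 1; with none, the bound is 2 <= 2k-1. *)
have out y : y \in ~: C ->
    2 * #|nbrs y :&: big| + #|nbrs y :\: C| <= (2 * k - 1) + 2 * (y \in F).
  rewrite [y \in F]inE !inE => ys.
  have bk : #|nbrs y :&: big| <= k.
    by apply: leq_trans card_big; rewrite subset_leq_card ?subsetIr.
  have [b0|] := posnP #|nbrs y :&: big|.
    by rewrite b0; have := outer_nbrs ys; rewrite -/C; lia.
  case/card_gt0P=> x; rewrite !inE => /and3P[yx xs _].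
  by have := outer_nbrs_attached ys xs yx; rewrite -/C; lia.
rewrite handshake (bigID (mem C)) /= (bigID (mem big)) /=.
have -> : \sum_(x in C | x \in big) #|nbrs x| = \sum_(x in big) #|nbrs x|.
  by apply: eq_bigl => x; case xB: (x \in big); rewrite ?andbF ?andbT // (subsetP BC).
have -> : \sum_(x in C | x \notin big) #|nbrs x| = \sum_(x in D) #|nbrs x|.
  by apply: eq_bigl => x; rewrite [x \in D]in_setD andbC.
have O_sum : \sum_(y | y \notin C) #|nbrs y| = \sum_(y in ~: C) #|nbrs y :&: big|
    + \sum_(y in ~: C) #|nbrs y :&: D| + \sum_(y in ~: C) #|nbrs y :\: C|.
  rewrite -!big_split /=; apply: eq_big => [y|y _]; first by rewrite in_setC.
  rewrite -(cardsID C (nbrs y)); congr (_ + _).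
  by rewrite -(cardsID big (_ :&: C)) -setIA (setIidPr BC) setIDA.
have : \sum_(y in ~: C) (2 * #|nbrs y :&: big| + #|nbrs y :\: C|)
    <= (2 * k - 1) * #|G| + 2 * #|F|.
  apply: (@leq_trans (\sum_(y in ~: C) (2 * k - 1 + 2 * (y \in F)))).
    exact: leq_sum.
  rewrite big_split /= sum_nat_const -big_distrr /=.
  rewrite mulnC leq_add ?leq_mul2l ?max_card ?orbT //.
  rewrite -sum1_card [X in _ <= X]big_mkcond [X in X <= _]big_mkcond leq_sum // => y _.
  by case: (y \in F); case: ifP.
rewrite big_split -big_distrr /= O_sum; nia.
Qed.

End LongCycle.

(** The threshold 100 k^2 generously exceeds the constants lost around a cycle of
    length at most 4k. *)
Lemma num_edges_broom_free : 100 * k ^ 2 <= #|G| ->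
  2 * num_edges G + k * (k + 1) <= 2 * k * #|G|.
Proof.
move=> Gbig; rewrite leqNgt; apply/negP => dense.
have [s [s_cycle s_uniq]] : exists s : seq G,
    [/\ cycle (@adj G) s, uniq s & 2 * k - 1 < size s].
  apply: (@erdos_gallai_cycle _ _ [set: G]); rewrite cardsT.
  rewrite (eq_bigl xpredT) => [|x]; last by rewrite in_setT.
  by under eq_bigr do rewrite setIT; rewrite -handshake; nia.
move=> s_size; have {}s_size : 2 * k <= size s by lia.
have [s4|s4] := ltnP (4 * k) (size s).
  have : 2 * num_edges G <= #|G| * 3.
    rewrite handshake -sum_nat_const; apply: leq_sum => v _.
    have [p [vp up sp]] := long_path_from s_cycle s_uniq s_size v.
    by apply: (start_very_long_path_deg vp up); lia.
  by nia.
have cB := card_big s_cycle s_uniq s_size.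
have E := num_edges_around_cycle s_cycle s_uniq s_size s4.
set F := [set y | _] in E.
have [F3|F3] := leqP (k + 3) #|F|; last by nia.
have [y0 y0F] : exists y, y \in F by apply/set0Pn; rewrite -card_gt0; lia.
have full y : y \in F -> nbrs y :&: big s = big s.
  rewrite inE => kb; apply/eqP; rewrite eqEcard subsetIr /=; exact: leq_trans kb.
have cBk : #|big s| = k.
  by apply/eqP; rewrite eqn_leq cB /= -(full _ y0F); move: y0F; rewrite inE.
have BF x w : x \in big s -> w \in F -> adj x w.
  by move=> xB /full e; move: xB; rewrite -e !inE adj_sym => /andP[].
have := num_edges_outer_independent cBk (no_outer_edge cBk F3 BF); nia.
Qed.

End BroomFree.

Theorem theorem1p6 (k : nat) (hk : 2 <= k) :
  exists n0 : nat, forall n : nat, n0 <= n ->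
    num_edges (S_plus n k) = k * n - (k * (k + 1)) %/ 2 + 1 /\
    forall G : sgraph, gorder G = n -> connected G ->
      num_edges (S_plus n k) <= num_edges G ->
      contains G (broom 2 (2 * k + 1)).
Proof.
exists (100 * k ^ 2) => n n0.
have kn : k + 2 <= n by nia.
have eS := num_edges_S_plus (ltnW hk) kn; split=> // G Gn Gc; rewrite eS => dense.
case: (contains_dec G (broom 2 (2 * k + 1))) => // free.
have := num_edges_broom_free hk Gc free; rewrite -/(gorder G) Gn => /(_ n0).
have := double_bin2 k; move: dense; set q := _ %/ 2; rewrite -addnn => dense hq.
by nia.
Qed.
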